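(* Let $S$ be a closed symmetric operator in a separable Hilbert space $\mathfrak H$, let $\mathcal H=\mathcal H_1\oplus\mathcal H_2$ be an orthogonal decomposition of a Hilbert space, and let $\Gamma:\mathfrak H^2\to\mathcal H^2$ be a boundary relation for $S^*$ such that $\Gamma$, $\Gamma^\top$ and $(\Gamma^{(2)})^\top$ satisfy the conditions (B1)–(B3), where $$\Gamma^{(2)}=\Big\{\Big\{\widehat f,\begin{pmatrix}h\\ P_{\mathcal H_2}h'\end{pmatrix}\Big\}:\Big\{\widehat f,\begin{pmatrix}h\\ h'\end{pmatrix}\Big\}\in\Gamma\text{ for some }h\in\mathcal H_2,\ h'\in\mathcal H\Big\}:\mathfrak H^2\to\mathcal H_2^2 .$$ Decompose the Weyl function corresponding to $\Gamma$ as $M(\lambda)=(M_{ij}(\lambda))_{i,j=1}^2$ with respect to $\mathcal H=\mathcal H_1\oplus\mathcal H_2$. Then: (i) the linear relation $$S^{(1)}=\Big\{\widehat f\in S^*:\Big\{\widehat f,\begin{pmatrix}h\\ 0\end{pmatrix}\Big\}\in\Gamma\text{ for some }h\in\mathcal H_2\Big\}$$ is closed and symmetric in $\mathfrak H$ and has equal defect numbers; (ii) the linear relation $$\Gamma'=\Big\{\Big\{\widehat f,\begin{pmatrix}P_{\mathcal H_1}h\\ h'\end{pmatrix}\Big\}:\Big\{\widehat f,\begin{pmatrix}h\\ h'\end{pmatrix}\Big\}\in\Gamma\text{ for some }h\in\mathcal H,\ h'\in\mathcal H_1\Big\}:\mathfrak H^2\to\mathcal H_1^2$$ is a boundary relation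 for $(S^{(1)})^*$ which satisfies the conditions (B1)–(B3); (iii) the corresponding Weyl function $M^{(1)}(\lambda)\in[\mathcal H_1]$ of $\Gamma'$ is given by $$M^{(1)}(\lambda)=M_{11}(\lambda)-M_{12}(\lambda)M_{22}(\lambda)^{-1}M_{21}(\lambda),\qquad\lambda\in\mathbb C\setminus\mathbb R.$$
   Context: A linear relation from $\mathfrak H_1$ to $\mathfrak H_2$ is a linear subspace of $\mathfrak H_1\times\mathfrak H_2$; $[\mathcal H]$ denotes the bounded everywhere defined operators in $\mathcal H$; $P_{\mathcal H_j}$ is the orthogonal projection onto $\mathcal H_j$. Write $\widehat f=\{f,f'\}$ etc.; pairs are also written as columns. $S^*$ is the adjoint linear relation. Boundary relation: for a closed symmetric linear relation $S$ in $\mathfrak H$, a linear relation $\Gamma:\mathfrak H^2\to\mathcal H^2$ is a boundary relation for $S^*$ if (G1) $\operatorname{dom}\Gamma$ is dense in $S^*$ and $(f',g)_{\mathfrak H}-(f,g')_{\mathfrak H}=(h',k)_{\mathcal H}-(h,k')_{\mathcal H}$ (Green's identity) for all $\{\widehat f,\widehat h\},\{\widehat g,\widehat k\}\in\Gamma$; (G2) every $\{\widehat g,\widehat k\}\in\mathfrak H^2\times\mathcal H^2$ satisfying this identity for all $\{\widehat f,\widehat h\}\in\Gamma$ belongs to $\Gamma$. Put $\Gamma_0=\{\{\widehat f,h\}:\{\widehat f,\widehat h\}\in\Gamma,\widehat h=\{h,h'\}\}$. The Weyl family is $M(\lambda)=\{\widehat h\in\mathcal H^2:\{\widehat f_\lambda,\widehat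 h\}\in\Gamma\text{ for some }\widehat f_\lambda=\{f,\lambda f\}\}$, $\lambda\in\mathbb C\setminus\mathbb R$. Transposed relation: $\Gamma^\top=\{\{\widehat f,J_{\mathcal H}\widehat h\}:\{\widehat f,\widehat h\}\in\Gamma\}$ with $J_{\mathcal H}=\begin{pmatrix}0&-iI\\ iI&0\end{pmatrix}$ (and similarly with $\mathcal H_2$ for $\Gamma^{(2)}$). Conditions (B1)–(B3) for a linear relation $\Gamma:\mathfrak H^2\to\mathcal H^2$: (B1) Green's identity holds; (B2) $\operatorname{ran}\Gamma_0=\mathcal H$; (B3) $\ker\Gamma_0$ is a selfadjoint linear relation in $\mathfrak H$. Under these conditions $M(\lambda)\in[\mathcal H]$ for every $\lambda\in\mathbb C\setminus\mathbb R$. *)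

(* Defs.v *)
From HB Require Import structures.
From mathcomp Require Import all_boot all_order all_algebra.
From mathcomp Require Import sesquilinear complex.
From mathcomp Require Import all_classical all_reals all_analysis.

Set Implicit Arguments.
Unset Strict Implicit.
Unset Printing Implicit Defensive.

Import Order.TTheory GRing.Theory Num.Theory.
Import numFieldNormedType.Exports.

Local Open Scope classical_set_scope.
Local Open Scope complex_scope.
Local Open Scope ring_scope.

(* [hdot] is linear in its first and conjugate-linear in its second argument. *)
HB.mixin Record CompleteNormedModule_isHilbert (R : realType) H
    of CompleteNormedModule R[i] H := {
  hdot : {dot H for (@Num.conj R[i])} ;
  hdotE : forall u : H, `|u| ^+ 2 = hdot u u
}.

#[short(type="hilbertType")]
HB.structure Definition Hilbert (R : realType) :=
  { H of CompleteNormedModule R[i] H & CompleteNormedModule_isHilbert R H }.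

Definition inner (R : realType) (H : hilbertType R) (u v : H) : R[i] :=
  (@hdot R H : H -> H -> R[i]) u v.

Definition separable (T : topologicalType) :=
  exists D : set T, countable D /\ dense D.

(* The norm on [U * V] is the maximum norm; it is equivalent to the Hilbert
   norm, so closures and closed sets in products are the usual ones. *)
Section LinearRelations.
Variables (R : realType) (H : hilbertType R).
Implicit Types S T : set (H * H).

Definition linear_relation (U V : lmodType R[i]) (T : set (U * V)) :=
  T 0 /\ forall (a : R[i]) u v, T u -> T v -> T (a *: u + v).

Definition adjoint T : set (H * H) :=
  [set g | forall f, T f -> inner f.2 g.1 = inner f.1 g.2].

Definition symmetric_relation S := S `<=` adjoint S.

Definition selfadjoint_relation S := linear_relation S /\ adjoint S = S.

Definition closed_symmetric_relation S :=
  [/\ linear_relation S, closed S & symmetric_relation S].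

Definition single_valued S := forall f', S (0, f') -> f' = 0.

Definition defect_subspace S (lambda : R[i]) : set H :=
  [set f | adjoint S (f, lambda *: f)].

(* A Hilbert space basis of a closed subspace [N]: a maximal orthonormal set. *)
Definition orthonormal_basis (N B : set H) :=
  [/\ B `<=` N,
      forall e, B e -> inner e e = 1,
      forall e e', B e -> B e' -> e <> e' -> inner e e' = 0 &
      forall x, N x -> (forall e, B e -> inner x e = 0) -> x = 0].

Definition same_hilbert_dimension (N N' : set H) :=
  exists B B' : set H,
    [/\ orthonormal_basis N B, orthonormal_basis N' B' & (B #= B')%card].

(* The defect numbers n_+(S) and n_-(S) are the dimensions of the defect
   subspaces at the points of the upper and of the lower half-plane; they do
   not depend on the point chosen in each half-plane. *)
Definition equal_defect_numbers S :=
  forall lambda mu : R[i], 0 < complex.Im lambda -> complex.Im mu < 0 ->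
    same_hilbert_dimension (defect_subspace S lambda) (defect_subspace S mu).

End LinearRelations.

Definition graph (U V : Type) (A : U -> V) : set (U * V) :=
  [set p | p.2 = A p.1].

Definition bounded_operator (R : realType) (U V : hilbertType R) (A : U -> V) :=
  linear A /\ exists c : R[i], forall x, `|A x| <= c * `|x|.

Definition bounded_inverse (R : realType) (U V : hilbertType R)
    (A : U -> V) (B : V -> U) :=
  [/\ bounded_operator B, cancel A B & cancel B A].

Section BoundaryRelations.
Variables (R : realType) (H K : hilbertType R).
Implicit Types Gamma : set ((H * H) * (K * K)).

Definition green_identity (f g : H * H) (h k : K * K) :=
  inner f.2 g.1 - inner f.1 g.2 = inner h.2 k.1 - inner h.1 k.2.

Definition green Gamma :=
  forall f h g k, Gamma (f, h) -> Gamma (g, k) -> green_identity f g h k.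

Definition rel_dom Gamma : set (H * H) := [set f | exists h, Gamma (f, h)].

Definition boundary_relation (S : set (H * H)) Gamma :=
  [/\ linear_relation Gamma,
      rel_dom Gamma `<=` adjoint S /\ adjoint S `<=` closure (rel_dom Gamma),
      green Gamma &
      forall g k, (forall f h, Gamma (f, h) -> green_identity f g h k) ->
        Gamma (g, k)].

Definition Gamma0 Gamma : set ((H * H) * K) :=
  [set p | exists h', Gamma (p.1, (p.2, h'))].

Definition ran_Gamma0 Gamma : set K :=
  [set h | exists f, Gamma0 Gamma (f, h)].

Definition ker_Gamma0 Gamma : set (H * H) :=
  [set f | Gamma0 Gamma (f, 0)].

Definition conditions_B Gamma :=
  [/\ linear_relation Gamma, green Gamma, ran_Gamma0 Gamma = setT &
      selfadjoint_relation (ker_Gamma0 Gamma)].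

Definition Jmap (h : K * K) : K * K := (- ('i *: h.2), 'i *: h.1).

Definition transposed Gamma : set ((H * H) * (K * K)) :=
  [set p | exists h, Gamma (p.1, h) /\ p.2 = Jmap h].

Definition weyl_family Gamma (lambda : R[i]) : set (K * K) :=
  [set h | exists f : H, Gamma ((f, lambda *: f), h)].

(* The operator whose graph is the Weyl family, when there is one. *)
Definition weyl_function Gamma (lambda : R[i]) (h : K) : K :=
  xget 0 [set h' | weyl_family Gamma lambda (h, h')].

Lemma weyl_functionP Gamma (lambda : R[i]) (A : K -> K) :
  weyl_family Gamma lambda = graph A -> weyl_function Gamma lambda = A.
Proof.
move=> GA; apply/funext => h; rewrite /weyl_function GA.
by case: xgetP => [h' _ Ah'|/(_ (A h))/(_ erefl)].
Qed.

End BoundaryRelations.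

(* K = K1 (+) K2: the summands are given with their isometric embeddings in K
   and with the coordinate maps of the orthogonal projections, so that the
   column of h : K is (proj1 h, proj2 h). *)
Record orthogonal_decomposition (R : realType) (K K1 K2 : hilbertType R) :=
  OrthogonalDecomposition {
    inj1 : {linear K1 -> K};
    inj2 : {linear K2 -> K};
    proj1 : {linear K -> K1};
    proj2 : {linear K -> K2};
    inj1_isometry : forall x y, inner (inj1 x) (inj1 y) = inner x y;
    inj2_isometry : forall x y, inner (inj2 x) (inj2 y) = inner x y;
    inj_orthogonal : forall x y, inner (inj1 x) (inj2 y) = 0;
    proj_split : forall h, h = inj1 (proj1 h) + inj2 (proj2 h)
  }.

Section Decomposed.
Variables (R : realType) (H K K1 K2 : hilbertType R).
Variable D : orthogonal_decomposition K K1 K2.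
Implicit Types Gamma : set ((H * H) * (K * K)).

Definition Gamma_2 Gamma : set ((H * H) * (K2 * K2)) :=
  [set p | exists (h : K2) (h' : K),
     Gamma (p.1, (inj2 D h, h')) /\ p.2 = (h, proj2 D h')].

Definition S_1 (S : set (H * H)) Gamma : set (H * H) :=
  [set f | adjoint S f /\ exists h : K2, Gamma (f, (inj2 D h, 0))].

Definition Gamma_prime Gamma : set ((H * H) * (K1 * K1)) :=
  [set p | exists (h : K) (h' : K1),
     Gamma (p.1, (h, inj1 D h')) /\ p.2 = (proj1 D h, h')].

Variable M : K -> K.
Definition block11 (x : K1) : K1 := proj1 D (M (inj1 D x)).
Definition block12 (x : K2) : K1 := proj1 D (M (inj2 D x)).
Definition block21 (x : K1) : K2 := proj2 D (M (inj1 D x)).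
Definition block22 (x : K2) : K2 := proj2 D (M (inj2 D x)).

End Decomposed.

(* Main.v *)
Require Import Defs.
From mathcomp Require Import all_boot all_order all_algebra.
From mathcomp Require Import sesquilinear complex.
From mathcomp Require Import ring lra.
From mathcomp Require Import all_classical all_reals all_analysis.
Set Implicit Arguments.
Unset Strict Implicit.
Unset Printing Implicit Defensive.
Import Order.TTheory GRing.Theory Num.Theory.
Import numFieldNormedType.Exports.
Local Open Scope classical_set_scope.
Local Open Scope complex_scope.
Local Open Scope ring_scope.

(** Everything here is a property of the single relation [Gamma'], once one
    knows that [Gamma'] satisfies [conditions_B]; and that fact comes from a
    coincidence of kernels.  The selfadjoint kernel supplied by the hypothesis
    on the transposed [Gamma_2] consists of the [f] for which [Gamma] has an
    element over [f] with [h] in [K2] and [h'] in [K1], and so does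
    [ker_Gamma0 Gamma'] ([ker_Gamma0_prime]).  Surjectivity of the first
    boundary value follows by correcting an element of [Gamma] with one of
    [Gamma_2], and Green's identity is inherited because [h'] lies in [K1].
    Finally [S1] is the kernel of [Gamma'] ([rel_ker_prime]).

    For an arbitrary [G] with [conditions_B] write [A] for the selfadjoint
    relation [ker_Gamma0 G].  Three facts then finish the proof.

    - [G] is a boundary relation for the adjoint of its kernel.  An element
      compatible with Green's identity can be corrected by elements of [G]
      until nothing is left, which gives maximality; maximality says that the
      kernel of [G] is the adjoint of the domain of [G], hence is closed and
      symmetric.  That the domain is dense in the adjoint of the kernel is
      reduced, by decomposing along [A], to the defect subspaces, where it is
      the projection theorem in the Hilbert space.

    - The kernel of [G] has the selfadjoint extension [A], so its defect
      numbers are equal.  The resolvents of [A] map any defect subspace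
      injectively into any other one; as the space is separable, orthonormal
      bases are countable and only finite dimensions have to be compared, which
      is a rank argument.

    - The Weyl family of [G] is the graph of an everywhere defined operator
      whose formal adjoint is the operator at the conjugate point.  An
      everywhere defined operator with an everywhere defined formal adjoint is
      bounded (Hellinger-Toeplitz).

    Applied to the transposed [Gamma_2], the last fact yields a bounded
    operator [N] with [N M22 = M22 N = -1]: transposition exchanges the two
    boundary values, so [-N] is the inverse of [M22].  The formula for the Weyl
    function of [Gamma'] is block elimination: one chooses the [K2]-component
    of [h] such that the [K2]-component of [M h] vanishes. *)

(** * Real-valued norms and the geometry of a Hilbert space *)

Section RealNorm.
Variable R : realType.

(** Norms take their values in [R[i]], whose order is only partial; their real
    parts can be compared, bounded and passed to infima. *)
Definition nrm (V : normedZmodType R[i]) (x : V) : R := complex.Re `|x|.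

Lemma nrmE (V : normedZmodType R[i]) (x : V) : `|x| = (nrm x)%:C.
Proof. by rewrite /nrm RRe_real // normr_real. Qed.

Variable V : normedZmodType R[i].
Implicit Types x y z : V.

Lemma nrm_ge0 x : 0 <= nrm x.
Proof. by rewrite -ler0c -nrmE. Qed.

Lemma nrm0 : nrm (0 : V) = 0.
Proof. by rewrite /nrm normr0. Qed.

Lemma nrm_eq0 x : nrm x = 0 -> x = 0.
Proof. by move=> x0; apply/normr0_eq0; rewrite nrmE x0. Qed.

Lemma nrmN x : nrm (- x) = nrm x.
Proof. by rewrite /nrm normrN. Qed.

Lemma nrm_distC x y : nrm (x - y) = nrm (y - x).
Proof. by rewrite /nrm distrC. Qed.

Lemma nrmD x y : nrm (x + y) <= nrm x + nrm y.
Proof. by rewrite -lecR rmorphD /= -!nrmE ler_normD. Qed.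

Lemma nrm_triangle z x y : nrm (x - y) <= nrm (x - z) + nrm (z - y).
Proof. by rewrite -lecR rmorphD /= -!nrmE ler_distD. Qed.

End RealNorm.


Lemma nrmM (R : realType) (a b : R[i]) : nrm (a * b) = nrm a * nrm b.
Proof. by apply/complexI; rewrite rmorphM /= -!nrmE normrM. Qed.

Lemma nrm_real (R : realType) (a : R) : nrm a%:C = `|a|.
Proof. by rewrite /nrm normc_def /= expr0n addr0 sqrtr_sqr. Qed.

Lemma nrmZ (R : realType) (V : normedModType R[i]) (a : R[i]) (x : V) :
  nrm (a *: x) = nrm a * nrm x.
Proof. by apply/complexI; rewrite rmorphM /= -!nrmE normrZ. Qed.

Lemma nrm_prod (R : realType) (U V : normedModType R[i]) (x : U * V) :
  nrm x = Num.max (nrm x.1) (nrm x.2).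
Proof.
apply/complexI; rewrite -nrmE prod_normE /= !nrmE /Order.max ltcR.
by case: ifP.
Qed.

Lemma nbhs_nrmP (R : realType) (V : normedModType R[i]) (x : V) (A : set V) :
  nbhs x A <-> exists2 e : R, 0 < e & forall y, nrm (x - y) < e -> A y.
Proof.
split=> [/nbhs_normP[e /= e0 eA]|[e e0 eA]].
  have ee : (complex.Re e)%:C = e by rewrite RRe_real // gtr0_real.
  exists (complex.Re e); first by rewrite -ltcR ee.
  by move=> y; rewrite -ltcR -nrmE ee => xy; apply: eA.
apply/nbhs_normP; exists e%:C; first by rewrite /= ltcR.
by move=> y /=; rewrite nrmE ltcR; exact: eA.
Qed.

Lemma closure_nrmP (R : realType) (V : normedModType R[i]) (A : set V) (x : V) :
  closure A x <-> forall e : R, 0 < e -> exists2 a, A a & nrm (x - a) < e.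
Proof.
split=> [cA e e0|cA B /nbhs_nrmP[e e0 eB]].
  have [|a [Aa xa]] := cA [set y | nrm (x - y) < e]; last by exists a.
  by apply/nbhs_nrmP; exists e.
by have [a Aa /eB Ba] := cA _ e0; exists a.
Qed.

Lemma cauchy_nrm_cvg (R : realType) (V : completeNormedModType R[i])
    (u : nat -> V) :
  (forall e : R, 0 < e -> exists N, forall n, (N <= n)%N -> nrm (u N - u n) < e) ->
  exists l, forall e : R, 0 < e ->
    exists N, forall n, (N <= n)%N -> nrm (l - u n) < e.
Proof.
move=> cu.
have /cauchy_cvgP/cvg_ex[l ul] : cauchy (u @ \oo).
  apply: cauchy_exP => e e0.
  have ee : (complex.Re e)%:C = e by rewrite RRe_real // gtr0_real.
  have [|N uN] := cu (complex.Re e); first by rewrite -ltcR ee.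
  exists (u N); exists N => // n /= /uN.
  by rewrite -ltcR -nrmE ee -ball_normE.
exists l => e e0.
have /nbhs_ballP : nbhs l [set y | nrm (l - y) < e] by apply/nbhs_nrmP; exists e.
case=> d d0 dl.
have /cvg_ballP/(_ d d0)[N _ uN] := ul.
by exists N => n /uN /dl.
Qed.

Section Inner.
Variables (R : realType) (H : hilbertType R).
Implicit Types (u v w : H) (a : R[i]).

Lemma innerDl u v w : inner (u + v) w = inner u w + inner v w.
Proof. exact: linearDl. Qed.
Lemma innerZl a u v : inner (a *: u) v = a * inner u v.
Proof. exact: linearZl_LR. Qed.
Lemma innerC u v : inner u v = Num.conj (inner v u).
Proof. by rewrite /inner hermC expr0 mul1r. Qed.
Lemma innerDr u v w : inner u (v + w) = inner u v + inner u w.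
Proof. by rewrite innerC innerDl rmorphD /= -!innerC. Qed.
Lemma innerZr a u v : inner u (a *: v) = Num.conj a * inner u v.
Proof. by rewrite innerC innerZl rmorphM /= -innerC. Qed.
Lemma innerNl u v : inner (- u) v = - inner u v.
Proof. by rewrite -scaleN1r innerZl mulN1r. Qed.
Lemma innerNr u v : inner u (- v) = - inner u v.
Proof. by rewrite innerC innerNl rmorphN /= -innerC. Qed.
Lemma innerBl u v w : inner (u - v) w = inner u w - inner v w.
Proof. by rewrite innerDl innerNl. Qed.
Lemma innerBr u v w : inner u (v - w) = inner u v - inner u w.
Proof. by rewrite innerDr innerNr. Qed.
Lemma inner0l v : inner 0 v = 0.
Proof. by rewrite -(scale0r v) innerZl mul0r. Qed.
Lemma inner0r v : inner v 0 = 0.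
Proof. by rewrite innerC inner0l rmorph0. Qed.
Lemma inner_suml I (s : seq I) (F : I -> H) v :
  inner (\sum_(i <- s) F i) v = \sum_(i <- s) inner (F i) v.
Proof.
elim: s => [|i s IH]; first by rewrite !big_nil inner0l.
by rewrite !big_cons innerDl IH.
Qed.

Lemma inner_nrm u : inner u u = (nrm u ^+ 2)%:C.
Proof. by rewrite /inner -hdotE nrmE rmorphXn. Qed.

Lemma inner_eq0 u : inner u u = 0 -> u = 0.
Proof.
by rewrite inner_nrm => /complexI /eqP; rewrite sqrf_eq0 => /eqP /nrm_eq0.
Qed.

Lemma inner_ext u v : (forall w, inner u w = inner v w) -> u = v.
Proof.
by move=> uv; apply/subr0_eq/inner_eq0; rewrite innerBl uv subrr.
Qed.

Lemma inner_sym0 u v : inner u v = 0 -> inner v u = 0.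
Proof. by move=> uv; rewrite innerC uv rmorph0. Qed.

Lemma pythagoras u v : inner u v = 0 -> nrm (u + v) ^+ 2 = nrm u ^+ 2 + nrm v ^+ 2.
Proof.
move=> uv; apply/complexI; rewrite rmorphD /= -!inner_nrm innerDl !innerDr.
by rewrite (inner_sym0 uv) uv addr0 add0r.
Qed.

Lemma parallelogram u v :
  nrm (u + v) ^+ 2 + nrm (u - v) ^+ 2 = (nrm u ^+ 2 + nrm v ^+ 2) *+ 2.
Proof.
apply/complexI; rewrite rmorphMn !rmorphD /= -!inner_nrm.
rewrite !(innerDl, innerDr, innerNl, innerNr).
move: (inner u v) (inner v u) (inner u u) (inner v v) => p q r s.
by ring.
Qed.

Lemma cauchy_schwarz u v : nrm (inner u v) <= nrm u * nrm v.
Proof.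
have [->|v0] := eqVneq v 0; first by rewrite inner0r !nrm0 mulr0.
have vv0 : inner v v != 0 by apply: contra_neq v0 => /inner_eq0.
(* The vector [c *: v] is the orthogonal projection of [u] on the line of [v]. *)
pose c := inner u v / inner v v; pose w := u - c *: v.
have wv : inner w (c *: v) = 0.
  by rewrite innerZr innerBl innerZl /c divfK // subrr mulr0.
have := pythagoras wv; rewrite subrK => uE.
have : nrm (c *: v) <= nrm u.
  by rewrite -(@ler_pXn2r _ 2) ?nnegrE ?nrm_ge0 // uE lerDr sqr_ge0.
have -> : inner u v = c * inner v v by rewrite /c divfK.
rewrite nrmM nrmZ inner_nrm nrm_real ger0_norm ?sqr_ge0 // expr2 mulrA => cv.
by rewrite ler_wpM2r ?nrm_ge0.
Qed.

End Inner.

(** Vectors are equal as soon as their inner products with every vector agree,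
    so that identities in a module become identities in the field of scalars. *)
Ltac vector_ring :=
  apply: inner_ext => ?; rewrite !(innerDl, innerNl, innerZl, inner0l); ring.

(** * The projection theorem *)

Lemma exists_invn_lt (R : realType) (e : R) : 0 < e -> exists n, n.+1%:R^-1 < e.
Proof.
move=> e0; exists (Num.bound e^-1).
rewrite -[ltRHS]invrK ltf_pV2 ?posrE ?invr_gt0 ?ltr0n //.
apply: lt_trans (_ : (Num.bound e^-1)%:R < _); last by rewrite ltr_nat.
by rewrite archi_boundP // invr_ge0 ltW.
Qed.

Lemma nrm_eps0 (R : realType) (V : normedZmodType R[i]) (z : V) (c : R) :
  0 <= c -> (forall e, 0 < e -> nrm z <= e * c) -> z = 0.
Proof.
move=> c0 zc; apply/nrm_eq0/eqP; rewrite eq_le nrm_ge0 andbT leNgt.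
apply/negP => z0.
have c1 : 0 < c + 1 by rewrite ltr_wpDl.
have := zc _ (divr_gt0 z0 c1); rewrite leNgt => /negP; apply.
by rewrite mulrAC ltr_pdivrMr // ltr_pM2l // ltrDl.
Qed.

(** On a product this unfolds to [linear_relation], so that the lemmas about it
    serve for relations and for subspaces of [H] alike. *)
Definition linear_subspace (R : realType) (V : lmodType R[i]) (A : set V) :=
  A 0 /\ forall (a : R[i]) u v, A u -> A v -> A (a *: u + v).

Lemma linear_subspaceD (R : realType) (V : lmodType R[i]) (A : set V) u v :
  linear_subspace A -> A u -> A v -> A (u + v).
Proof. by case=> _ lA Au Av; rewrite -[u]scale1r; exact: lA. Qed.

Lemma linear_subspaceZ (R : realType) (V : lmodType R[i]) (A : set V) a u :
  linear_subspace A -> A u -> A (a *: u).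
Proof. by case=> A0 lA Au; rewrite -[_ *: _]addr0; exact: lA. Qed.

Lemma linear_subspaceB (R : realType) (V : lmodType R[i]) (A : set V) u v :
  linear_subspace A -> A u -> A v -> A (u - v).
Proof.
by case=> _ lA Au Av; rewrite addrC -[- v]scaleN1r; exact: lA.
Qed.

Section Projection.
Variables (R : realType) (H : hilbertType R).

(** The variational inequality behind the projection theorem: subtracting from
    [p] its component along [w] lowers the square of its norm by the square of
    [nrm (inner p w) / nrm w], so that a vector which is almost shortest among
    all [p - c *: w] is almost orthogonal to [w]. *)
Lemma inner_excess (p w : H) (d : R) :
  (forall c : R[i], d <= nrm (p - c *: w) ^+ 2) ->
  nrm (inner p w) ^+ 2 <= (nrm p ^+ 2 - d) * nrm w ^+ 2.
Proof.
have [->|w0] := eqVneq w 0.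
  by rewrite inner0r !nrm0 expr0n /= mulr0.
have ww0 : inner w w != 0 by apply: contra_neq w0 => /inner_eq0.
pose c := inner p w / inner w w => /(_ c) dc.
have pw : inner (p - c *: w) (c *: w) = 0.
  by rewrite innerZr innerBl innerZl /c divfK // subrr mulr0.
have := pythagoras pw; rewrite subrK => pE.
have -> : inner p w = c * inner w w by rewrite /c divfK.
rewrite nrmM inner_nrm nrm_real ger0_norm ?sqr_ge0 //.
have -> : (nrm c * nrm w ^+ 2) ^+ 2 = nrm (c *: w) ^+ 2 * nrm w ^+ 2.
  by rewrite nrmZ; ring.
by apply: ler_wpM2r; [exact: sqr_ge0|rewrite pE; lra].
Qed.

(** A minimizing sequence of distances is Cauchy by the parallelogram identity,
    and [inner_excess] makes its limit orthogonal to the subspace. *)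
Theorem projection_theorem (V : set H) : linear_subspace V -> closed V ->
  forall x, exists2 v, V v & forall w, V w -> inner (x - v) w = 0.
Proof.
move=> lV cV x; pose E := [set nrm (x - v) ^+ 2 | v in V].
have hE : has_inf E.
  split; first by exists (nrm (x - 0) ^+ 2); exists 0 => //; case: lV.
  by exists 0 => _ [v _ <-]; exact: sqr_ge0.
pose d := inf E.
have dV v : V v -> d <= nrm (x - v) ^+ 2.
  by move=> Vv; apply: ge_inf; [case: hE|exists v].
have /choice[v_ v_P] (n : nat) :
    exists v, V v /\ nrm (x - v) ^+ 2 < d + n.+1%:R^-1.
  have [|_ [v Vv <-] vd] := @inf_adherent _ E n.+1%:R^-1 _ hE.
    by rewrite invr_gt0 ltr0n.
  by exists v.
have vB m n : (m <= n)%N -> nrm (v_ m - v_ n) ^+ 2 <= 4 * m.+1%:R^-1.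
  move=> mn; have [Vm dm] := v_P m; have [Vn dn] := v_P n.
  have := parallelogram (x - v_ m) (x - v_ n).
  have -> : x - v_ m - (x - v_ n) = v_ n - v_ m by rewrite opprB addrC subrKA.
  have -> : x - v_ m + (x - v_ n) = 2 *: (x - 2^-1 *: (v_ m + v_ n)).
    rewrite scalerBr scalerA divff ?pnatr_eq0 // scale1r scaler_nat mulr2n.
    by rewrite opprD addrACA.
  (* The midpoint of two almost minimizers is itself a competitor. *)
  have := dV _ (linear_subspaceZ 2^-1 lV (linear_subspaceD lV Vm Vn)).
  rewrite nrmZ (nrm_distC (v_ m) (v_ n)).
  have -> : nrm (2 : R[i]) = 2 :> R.
    by rewrite -(rmorph_nat (real_complex R)) nrm_real normr_nat.
  have : n.+1%:R^-1 <= m.+1%:R^-1 :> R by rewrite lef_pV2 ?posrE // ler_nat.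
  rewrite exprMn mulr2n; move: dm dn.

  move: (m.+1%:R^-1) (n.+1%:R^-1) => a b *; lra.
have [e e0|l vl] := @cauchy_nrm_cvg _ H v_.
  have [|N Ne] := @exists_invn_lt _ (e ^+ 2 / 4).
    by rewrite divr_gt0 // exprn_gt0.
  exists N => n Nn; rewrite -(@ltr_pXn2r _ 2) ?nnegrE ?nrm_ge0 ?(ltW e0) //.
  apply: le_lt_trans (vB _ _ Nn) _.
  by move: Ne; rewrite ltr_pdivlMr // mulrC.
exists l.
  rewrite (_ : V = closure V); last by rewrite -closure_id.
  apply/closure_nrmP => e e0; have [N lN] := vl e e0.
  by exists (v_ N); [case: (v_P N)|exact: lN].
move=> w Vw; apply: (@nrm_eps0 _ _ _ (2 * nrm w)).
  by rewrite mulr_ge0 ?nrm_ge0.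
move=> e e0; have [N lN] := vl e e0.
have [m me] := @exists_invn_lt _ (e ^+ 2) (exprn_gt0 _ e0).
pose n := maxn N m.
have [Vn dn] := v_P n.
have : nrm (inner (x - v_ n) w) <= e * nrm w.
  rewrite -(@ler_pXn2r _ 2) ?nnegrE ?nrm_ge0 ?mulr_ge0 ?nrm_ge0 ?(ltW e0) //.
  rewrite exprMn.
  apply: (le_trans (@inner_excess _ _ d _)).
    move=> c; rewrite -addrA -opprD; apply: dV; rewrite addrC.
    by case: lV => _; exact.
  apply: ler_wpM2r; first exact: sqr_ge0.
  have : n.+1%:R^-1 <= m.+1%:R^-1 :> R.
    by rewrite lef_pV2 ?posrE // ler_nat ltnS leq_maxr.
  by move: dn me; move: (n.+1%:R^-1) (m.+1%:R^-1) => a b; lra.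
have := cauchy_schwarz (l - v_ n) w.
have := ler_wpM2r (nrm_ge0 w) (ltW (lN n (leq_maxl _ _))).
have -> : inner (x - l) w = inner (x - v_ n) w - inner (l - v_ n) w.
  by rewrite -innerBl opprB addrA subrK.
have := nrmD (inner (x - v_ n) w) (- inner (l - v_ n) w); rewrite nrmN.
by lra.
Qed.

Corollary dense_of_trivial_complement (V : set H) :
  linear_subspace V -> closed V ->
  (forall g, (forall w, V w -> inner g w = 0) -> g = 0) -> forall x, V x.
Proof.
move=> lV cV V0 x; have [v Vv xv] := projection_theorem lV cV x.
by rewrite -(subrK v x) (V0 _ xv) add0r.
Qed.

End Projection.

(** * The Hellinger-Toeplitz theorem *)

Section HellingerToeplitz.
Variables (R : realType) (K : hilbertType R) (A A' : K -> K).
Hypothesis AA' : forall u v, inner (A u) v = inner u (A' v).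

Lemma adjointable_linear : linear A.
Proof.
move=> a u v; apply/eqP; rewrite -subr_eq0; apply/eqP/inner_eq0.
set w := _ - _; rewrite {1}/w innerBl innerDl innerZl !AA' innerDl innerZl.
by rewrite subrr.
Qed.

(** If [A] is unbounded, some vector [A h] is as long as desired compared with
    [h]; moving [x] by [r] in the direction of [A h], with one of the two
    signs, makes its inner product with [A h] at least [r * nrm (A h)]. *)
Lemma hump (c r : R) (x : K) : 0 <= c -> 0 < r ->
  ~ (exists C : R, forall h, nrm (A h) <= C * nrm h) ->
  exists y, nrm (y - x) <= r /\
    exists h, c * nrm h < nrm (A h) /\ r * nrm (A h) <= nrm (inner y (A h)).
Proof.
move=> c0 r0 uA.
have [h Ah] : exists h, c * nrm h < nrm (A h).
  apply: contra_notP uA => /forallNP nA; exists c => h.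
  by rewrite leNgt; apply/negP.
have Ah0 : 0 < nrm (A h) by apply: le_lt_trans Ah; rewrite mulr_ge0 ?nrm_ge0.
pose e := (r / nrm (A h))%:C *: A h.
have ne : nrm e = r.
  rewrite nrmZ nrm_real ger0_norm ?divfK ?gt_eqF //.
  by rewrite divr_ge0 ?ltW.
have eA : nrm (inner e (A h)) = r * nrm (A h).
  rewrite innerZl nrmM inner_nrm !nrm_real !ger0_norm ?sqr_ge0 ?divr_ge0 ?ltW //.
  by rewrite expr2 mulrA divfK // gt_eqF.
have [xe|xe] := leP (r * nrm (A h)) (nrm (inner (x + e) (A h))).
  exists (x + e); rewrite [x + e]addrC addrK [e + x]addrC ne.
  by split => //; exists h.
exists (x - e); rewrite [x - e]addrC addrK [- e + x]addrC nrmN ne; split => //.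
exists h; split => //.
move: xe; rewrite innerDl innerBl.
have := nrmD (inner x (A h) + inner e (A h)) (- (inner x (A h) - inner e (A h))).
rewrite (_ : _ - _ = inner e (A h) *+ 2); last by rewrite mulr2n opprB; ring.
have -> : nrm (inner e (A h) *+ 2) = nrm (inner e (A h)) *+ 2.
  by rewrite /nrm normrMn raddfMn.
by rewrite nrmN eA mulr2n; lra.
Qed.

(** A gliding hump replaces the uniform boundedness principle.  If [A] were
    unbounded, moving a point by [3^-n] at step [n] would lead to a limit [l]
    for which the norm of [inner l (A h_n)] exceeds [n * nrm h_n] for every
    [n]; but this number is [inner (A' l) h_n], of norm at most
    [nrm (A' l) * nrm h_n]. *)
Theorem hellinger_toeplitz : bounded_operator A.
Proof.
split; first exact: adjointable_linear.
suff [C CA] : exists C : R, forall h, nrm (A h) <= C * nrm h.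
  by exists C%:C => h; rewrite !nrmE -rmorphM lecR.
apply: contrapT => uA.
pose r n : R := 3^-1 ^+ n.
have r0 n : 0 < r n by rewrite exprn_gt0 // invr_gt0.
have /choice[s sP] (p : nat * K) : exists y, nrm (y - p.2) <= r p.1 /\
    exists h, 2 * p.1%:R / r p.1 * nrm h < nrm (A h) /\
              r p.1 * nrm (A h) <= nrm (inner y (A h)).
  by apply: hump => //; rewrite divr_ge0 ?mulr_ge0 ?ler0n // ltW.
pose x := fix x n := if n is m.+1 then s (m, x m) else 0.
have x_step n : nrm (x n.+1 - x n) <= r n by have [] := sP (n, x n).
(* For [m = n.+1] the bound is half of [r n]: the steps after step [n]
   cannot undo more than half of the growth that it achieved. *)
have x_tail m n : nrm (x m - x (m + n)%N) <= 3 / 2 * r m.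
  suff : nrm (x m - x (m + n)%N) <= 3 / 2 * (r m - r (m + n)%N).
    by have := r0 (m + n)%N; lra.
  elim: n => [|n IH]; first by rewrite addn0 !subrr nrm0 mulr0.
  rewrite addnS; apply: le_trans (nrm_triangle (x (m + n)%N) _ _) _.
  have := x_step (m + n)%N; rewrite (nrm_distC (x _.+1)) => xs.
  have : r (m + n).+1 = 3^-1 * r (m + n)%N by rewrite /r exprS.
  by move=> rE; lra.
have r_lt e : 0 < e -> exists n, 3 / 2 * r n < e.
  move=> e0; pose n := Num.bound (2 / e); exists n.
  have n2 : 2 / e < n%:R by rewrite archi_boundP // divr_ge0 // ltW.
  have n3 : n%:R < (3 ^ n)%:R :> R by rewrite ltr_nat ltn_expl.
  have rn : r n * (3 ^ n)%:R = 1.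
    by rewrite natrX /r exprVn mulVf // expf_neq0.
  have : 2 < e * (3 ^ n)%:R.
    by rewrite -ltr_pdivrMl // mulrC; exact: lt_trans n3.
  rewrite -(ltr_pM2l (r0 n)) mulrCA rn mulr1.
  by have := r0 n; lra.
have [e e0|l xl] := @cauchy_nrm_cvg _ K x.
  have [N Ne] := r_lt e e0; exists N => n /subnKC <-.
  exact: le_lt_trans (x_tail _ _) Ne.
have lx n : nrm (l - x n) <= 3 / 2 * r n.
  apply/ler_addgt0Pr => e e0; have [N lN] := xl e e0.
  apply: le_trans (nrm_triangle (x (n + N)%N) _ _) _.
  rewrite addrC lerD // ?x_tail //; last by rewrite ltW // lN ?leq_addl.
  by rewrite nrm_distC x_tail.
pose n := Num.bound (nrm (A' l)).
have nA : nrm (A' l) < n%:R by rewrite archi_boundP // nrm_ge0.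
have [_ [h [ch rh]]] := sP (n, x n).
have /= {}rh : r n * nrm (A h) <= nrm (inner (x n.+1) (A h)) := rh.
move: ch => /=; rewrite mulrAC ltr_pdivrMr // => ch.
have h1 : nrm (inner l (A h)) <= nrm (A' l) * nrm h.
  rewrite innerC AA' -innerC; exact: cauchy_schwarz.
have h2 : nrm (inner (x n.+1) (A h)) <=
    nrm (inner l (A h)) + nrm (l - x n.+1) * nrm (A h).
  have -> : inner (x n.+1) (A h) = inner l (A h) - inner (l - x n.+1) (A h).
    by rewrite innerBl subKr.
  apply: le_trans (nrmD _ _) _; rewrite lerD2l nrmN; exact: cauchy_schwarz.
have h3 : nrm (l - x n.+1) * nrm (A h) <= 2^-1 * r n * nrm (A h).
  apply: ler_wpM2r; first exact: nrm_ge0.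
  by apply: le_trans (lx _) _; rewrite /r exprS mulrA; lra.
have h4 : nrm (A' l) * nrm h <= n%:R * nrm h.
  by apply: ler_wpM2r; [exact: nrm_ge0|exact: ltW].
by lra.
Qed.

End HellingerToeplitz.

(** * Resolvents of selfadjoint relations *)

Section Relations.
Variables (R : realType) (H : hilbertType R).
Implicit Types (S T A : set (H * H)) (l : R[i]).

Lemma adjoint_linear T : linear_subspace (adjoint T).
Proof.
split=> [|a u v Tu Tv] f Tf /=; first by rewrite !inner0r.
by rewrite !innerDr !innerZr Tu // Tv.
Qed.

Lemma adjoint_sub S T : S `<=` T -> adjoint T `<=` adjoint S.
Proof. by move=> ST g Tg f /ST; exact: Tg. Qed.

Lemma adjoint_closed T : closed (adjoint T).
Proof.
move=> g /closure_nrmP cg f Tf; apply/subr0_eq.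
apply: (@nrm_eps0 _ _ _ (nrm f.2 + nrm f.1)); first by rewrite addr_ge0 ?nrm_ge0.
move=> e e0; have [k Tk] := cg e e0.
rewrite nrm_prod gt_max => /andP[k1 k2].
have -> : inner f.2 g.1 - inner f.1 g.2 =
    inner f.2 (g.1 - k.1) - inner f.1 (g.2 - k.2).
  by rewrite !innerBr (Tk _ Tf); ring.
apply: le_trans (nrmD _ _) _; rewrite nrmN mulrDr.
by apply: lerD; apply: le_trans (cauchy_schwarz _ _) _;
  rewrite mulrC ler_wpM2r ?nrm_ge0 ?ltW.
Qed.

Lemma nonreal_conj l : l \isn't Num.real -> Num.conj l \isn't Num.real.
Proof. by rewrite !CrealE conjCK eq_sym. Qed.

Lemma nonreal_gap l : l \isn't Num.real -> 0 < nrm (l - Num.conj l).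
Proof.
move=> lNR; rewrite lt_neqAle nrm_ge0 andbT eq_sym.
apply: contra lNR => /eqP/nrm_eq0/subr0_eq lE.
by rewrite CrealE -lE.
Qed.

(** For [a] in a symmetric relation [inner a.2 a.1] is real, so the imaginary
    part of [inner (a.2 - l *: a.1) a.1] comes from [l] alone. *)
Lemma symmetric_lower_bound S l a : symmetric_relation S -> S a ->
  nrm (l - Num.conj l) * nrm a.1 <= 2 * nrm (a.2 - l *: a.1).
Proof.
move=> symS Sa.
have [->|a0] := eqVneq (nrm a.1) 0; first by rewrite mulr0 mulr_ge0 ?nrm_ge0.
have {a0} a0 : 0 < nrm a.1 by rewrite lt_neqAle eq_sym a0 nrm_ge0.
rewrite -(ler_pM2r a0) -mulrA -expr2.
set w := a.2 - _.
have -> : nrm (l - Num.conj l) * nrm a.1 ^+ 2 =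
    nrm (inner a.1 w - inner w a.1).
  rewrite /w innerBl innerBr innerZl innerZr (symS _ Sa _ Sa).
  rewrite -[LHS](_ : nrm ((l - Num.conj l) * inner a.1 a.1) = _).
    by congr nrm; ring.
  by rewrite nrmM inner_nrm nrm_real ger0_norm ?sqr_ge0.
apply: le_trans (nrmD _ _) _; rewrite nrmN.
have := cauchy_schwarz a.1 w; have := cauchy_schwarz w a.1.
by rewrite (mulrC (nrm a.1)); lra.
Qed.

Lemma symmetric_eigen0 S l z : symmetric_relation S -> l \isn't Num.real ->
  S (z, l *: z) -> z = 0.
Proof.
move=> symS lNR /(symmetric_lower_bound l symS) /=.
rewrite subrr nrm0 mulr0 pmulr_rle0 ?nonreal_gap // => z0.
by apply/nrm_eq0/le_anti; rewrite z0 nrm_ge0.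
Qed.

Lemma selfadjoint_symmetric A : selfadjoint_relation A -> symmetric_relation A.
Proof. by case=> _ AA; rewrite /symmetric_relation AA. Qed.

Lemma selfadjoint_closed A : selfadjoint_relation A -> closed A.
Proof. by case=> _ <-; exact: adjoint_closed. Qed.

(** By [symmetric_lower_bound] convergence of [a.2 - l *: a.1] forces
    convergence of [a.1], hence of [a.2], and [A] is closed. *)
Lemma selfadjoint_closed_range A l : selfadjoint_relation A ->
  l \isn't Num.real -> closed [set a.2 - l *: a.1 | a in A].
Proof.
move=> saA lNR y /closure_nrmP cy.
have symA := selfadjoint_symmetric saA.
have cA := selfadjoint_closed saA; have [lA AA] := saA.
have /choice[a_ a_P] (n : nat) :
    exists a, A a /\ nrm (y - (a.2 - l *: a.1)) < n.+1%:R^-1.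
  have [|_ [a Aa <-] ya] := cy n.+1%:R^-1; first by rewrite invr_gt0 ltr0n.
  by exists a.
pose d := nrm (l - Num.conj l); have d0 : 0 < d by exact: nonreal_gap.
have a_close n m : (n <= m)%N ->
    d * nrm ((a_ n).1 - (a_ m).1) <= 4 * n.+1%:R^-1.
  move=> nm; have [An yn] := a_P n; have [Am ym] := a_P m.
  have := symmetric_lower_bound l symA (linear_subspaceB lA An Am) => /=.
  have -> : (a_ n).2 - (a_ m).2 - l *: ((a_ n).1 - (a_ m).1) =
     (y - ((a_ m).2 - l *: (a_ m).1)) - (y - ((a_ n).2 - l *: (a_ n).1)).
    by vector_ring.
  have := nrmD (y - ((a_ m).2 - l *: (a_ m).1)) (- (y - ((a_ n).2 - l *: (a_ n).1))).
  have : m.+1%:R^-1 <= n.+1%:R^-1 :> R by rewrite lef_pV2 ?posrE // ler_nat.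
  rewrite nrmN -/d; move: yn ym.
  by move: (n.+1%:R^-1) (m.+1%:R^-1) => p q; lra.
have [e e0|x ax] := @cauchy_nrm_cvg _ H (fun n => (a_ n).1).
  have [|N Ne] := @exists_invn_lt _ (d * e / 4).
    by rewrite !mulr_gt0 // invr_gt0.
  exists N => n Nn; rewrite -(ltr_pM2l d0); apply: le_lt_trans (a_close _ _ Nn) _.
  by move: Ne; move: (N.+1%:R^-1) => p; lra.
exists (x, y + l *: x); last by rewrite /= addrK.
rewrite (_ : A = closure A); last by rewrite -closure_id.
apply/closure_nrmP => e e0.
have e'0 : 0 < e / (2 * (1 + nrm l)).
  by rewrite divr_gt0 // mulr_gt0 // ltr_wpDr ?nrm_ge0.
have [N aN] := ax _ e'0.
have [|M Me] := @exists_invn_lt _ (e / 2); first by rewrite divr_gt0.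
pose n := maxn N M; have [An yn] := a_P n.
have xn : nrm (x - (a_ n).1) < e / (2 * (1 + nrm l)) := aN n (leq_maxl _ _).
have l0 := nrm_ge0 l.
have xe : nrm (x - (a_ n).1) * (2 * (1 + nrm l)) < e.
  by rewrite -ltr_pdivlMr // mulr_gt0 // ltr_wpDr.
have x0 := nrm_ge0 (x - (a_ n).1).
have lx0 : 0 <= nrm l * nrm (x - (a_ n).1) by rewrite mulr_ge0.
exists (a_ n) => //; rewrite nrm_prod gt_max /=; apply/andP; split; first by lra.
have -> : y + l *: x - (a_ n).2 =
    (y - ((a_ n).2 - l *: (a_ n).1)) + l *: (x - (a_ n).1).
  by vector_ring.
have := nrmD (y - ((a_ n).2 - l *: (a_ n).1)) (l *: (x - (a_ n).1)).
have : n.+1%:R^-1 <= M.+1%:R^-1 :> R.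
  by rewrite lef_pV2 ?posrE // ler_nat ltnS leq_maxr.
rewrite nrmZ; move: Me yn; move: (n.+1%:R^-1) (M.+1%:R^-1) => p q.
by lra.
Qed.

(** A vector orthogonal to this closed range is an eigenvector of the adjoint
    of [A], that is of [A], at the conjugate of [l]; hence it is zero. *)
Lemma selfadjoint_range A l : selfadjoint_relation A -> l \isn't Num.real ->
  forall y, exists2 a, A a & a.2 - l *: a.1 = y.
Proof.
move=> saA lNR y; have [lA AA] := saA.
apply: dense_of_trivial_complement (selfadjoint_closed_range saA lNR) _ y.
  split; first by exists 0; [case: lA|rewrite scaler0 subr0].
  move=> c _ _ [a Aa <-] [b Ab <-]; exists (c *: a + b).
    by case: lA => _; exact.
  by rewrite /=; vector_ring.
move=> g gV; have symA := selfadjoint_symmetric saA.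
apply: (symmetric_eigen0 symA (nonreal_conj lNR)).
rewrite -AA => a Aa /=; apply/subr0_eq.
rewrite innerZr conjCK -innerZl -innerBl.
by apply/inner_sym0/gV; exists a.
Qed.

Lemma selfadjoint_resolvent A l : selfadjoint_relation A -> l \isn't Num.real ->
  exists2 Res : H -> H, linear Res & forall y, A (Res y, y + l *: Res y).
Proof.
move=> saA lNR.
have /choice[Res ResP] y : exists z, A (z, y + l *: z).
  by have [[z z'] Az <-] := selfadjoint_range saA lNR y; exists z; rewrite subrK.
exists Res => // c u v; apply/subr0_eq.
apply: (symmetric_eigen0 (selfadjoint_symmetric saA) lNR).
have [lA _] := saA.
have := linear_subspaceB lA (ResP (c *: u + v))
  (linear_subspaceD lA (linear_subspaceZ c lA (ResP u)) (ResP v)).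
congr (A (_, _)) => /=.
by vector_ring.
Qed.

(** The von Neumann decomposition along a selfadjoint relation: modulo [A]
    every pair is of the form [(z, l *: z)].  It reduces questions about
    relations to questions about defect subspaces of [H]. *)
Lemma selfadjoint_decomposition A l : selfadjoint_relation A ->
  l \isn't Num.real -> forall g, exists2 a, A a & exists z, g = a + (z, l *: z).
Proof.
move=> saA lNR g; have [a Aa ag] := selfadjoint_range saA lNR (g.2 - l *: g.1).
exists a => //; exists (g.1 - a.1); apply/eqP; rewrite [g]surjective_pairing.
apply/eqP; congr pair => /=; first by rewrite addrC subrK.
by rewrite -[LHS](subrK (l *: g.1)) -ag; vector_ring.
Qed.

End Relations.

(** * Boundary relations with a selfadjoint kernel *)

Section ConditionsB.
Variables (R : realType) (H K : hilbertType R).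
Variable G : set ((H * H) * (K * K)).
Hypothesis BG : conditions_B G.

Definition rel_ker (T : set ((H * H) * (K * K))) : set (H * H) :=
  [set f | T (f, 0)].

(** A pair [(g, k)] compatible with Green's identity is corrected by elements
    of [G] in two steps: one with first boundary value [k.1] removes that value,
    then selfadjointness of [ker_Gamma0 G] removes [g].  What remains is
    [(0, (0, y))], with [y] orthogonal to all first boundary values. *)
Lemma conditions_B_maximal g k :
  (forall f h, G (f, h) -> green_identity f g h k) -> G (g, k).
Proof.
have [lG gG ranG [lA AA]] := BG => gk.
have [f [k' Gf]] : ran_Gamma0 G k.1 by rewrite ranG.
pose g1 := g - f; pose k1 := k - (k.1, k').
have g1P a h : G (a, h) -> green_identity a g1 h k1.
  move=> Ga; have := gk _ _ Ga; have := gG _ _ _ _ Ga Gf.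
  rewrite /green_identity /g1 /k1 /= !innerBr => E1 E2.
  transitivity (inner a.2 g.1 - inner a.1 g.2 -
      (inner a.2 f.1 - inner a.1 f.2)); first by ring.
  by rewrite E1 E2; ring.
have k11 : k1.1 = 0 by rewrite /= subrr.
have [x Gx] : ker_Gamma0 G g1.
  rewrite -AA => a [x Gx]; apply/subr0_eq.
  by rewrite (g1P _ _ Gx) k11 inner0r inner0l subr0.
have k1x : k1 = (0, x).
  suff : x - k1.2 = 0 by move/subr0_eq ->; rewrite -k11; case: (k1).
  apply: inner_eq0.
  have [a [h' Ga]] : ran_Gamma0 G (x - k1.2) by rewrite ranG.
  have := g1P _ _ Ga; rewrite /green_identity (gG _ _ _ _ Ga Gx) k11 /=.
  rewrite !inner0r !sub0r.
  by move=> /oppr_inj E; rewrite innerBr E subrr.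
have := linear_subspaceD lG Gx Gf; rewrite -k1x.
by congr G; rewrite /g1 /k1; congr pair; rewrite subrK.
Qed.

(** Green's identity for [(g, 0)] says that [g] is in the adjoint of the domain;
    by maximality this is membership of [(g, 0)] in [G]. *)
Lemma adjoint_rel_dom : adjoint (rel_dom G) = rel_ker G.
Proof.
have [_ gG _ _] := BG.
apply/seteqP; split=> [g gD|g Gg f [h Gf]].
  apply: conditions_B_maximal => f h Gf.
  by rewrite /green_identity gD ?subrr ?inner0r ?subrr //; exists h.
by apply/subr0_eq; rewrite (gG _ _ _ _ Gf Gg) !inner0r subrr.
Qed.

Lemma rel_ker_sub_ker_Gamma0 : rel_ker G `<=` ker_Gamma0 G.
Proof. by move=> f Gf; exists 0. Qed.

Lemma rel_ker_closed_symmetric : closed_symmetric_relation (rel_ker G).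
Proof.
have [_ _ _ saA] := BG.
split; rewrite -?adjoint_rel_dom; [exact: adjoint_linear|exact: adjoint_closed|].
rewrite adjoint_rel_dom => f /rel_ker_sub_ker_Gamma0 Af.
apply: (adjoint_sub rel_ker_sub_ker_Gamma0).
exact: selfadjoint_symmetric saA _ Af.
Qed.

(** Both [rel_dom G] and the adjoint of [rel_ker G] contain the selfadjoint
    relation [ker_Gamma0 G], so only their parts [(z, l *: z)] have to be
    compared; these are subspaces of [H], where the projection theorem
    applies. *)
Lemma rel_dom_dense : adjoint (rel_ker G) `<=` closure (rel_dom G).
Proof.
have [[G0 lG] gG _ saA] := BG.
have lD : linear_subspace (rel_dom G).
  split; first by exists 0.
  by move=> c u v [h Gu] [k Gv]; exists (c *: h + k); exact: lG _ _ _ Gu Gv.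
have AD : ker_Gamma0 G `<=` rel_dom G by move=> f [h Gf]; exists (0, h).
(* Any nonreal point would do. *)
pose l : R[i] := 'i.
have lNR : l \isn't Num.real.
  by rewrite CrealE conjCi eq_sym -addr_eq0 -mulr2n mulrn_eq0 /= neq0Ci.
move=> g gS.
have [a Aa [x gax]] := selfadjoint_decomposition saA lNR g.
have aS : adjoint (rel_ker G) a.
  apply: (adjoint_sub rel_ker_sub_ker_Gamma0).
  exact: selfadjoint_symmetric saA _ Aa.
have xS : adjoint (rel_ker G) (x, l *: x).
  by have := linear_subspaceB (adjoint_linear _) gS aS; rewrite gax addrC addKr.
pose N := [set z | rel_dom G (z, l *: z)].
have lN : linear_subspace N.
  split; first by rewrite /N /= scaler0; case: lD.
  move=> c u v Nu Nv; have := lD.2 c _ _ Nu Nv.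
  by congr (rel_dom G (_, _)) => /=; vector_ring.
have lcN : linear_subspace (closure N).
  split; first by apply: subset_closure; case: lN.
  move=> c u v /closure_nrmP cu /closure_nrmP cv; apply/closure_nrmP => e e0.
  have c1 : 0 < 2 * (1 + nrm c) by rewrite mulr_gt0 // ltr_wpDr ?nrm_ge0.
  have [u' Nu' uu'] := cu _ (divr_gt0 e0 c1).
  have [v' Nv' vv'] := cv (e / 2) (divr_gt0 e0 (ltr0n R 2)).
  exists (c *: u' + v'); first by case: lN => _; exact.
  rewrite (_ : _ - _ = c *: (u - u') + (v - v')); last by vector_ring.
  apply: le_lt_trans (nrmD _ _) _; rewrite nrmZ.
  have c0 := nrm_ge0 c; have u0 := nrm_ge0 (u - u').
  move: uu'; rewrite ltr_pdivlMr // => uu'.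
  by lra.
suff cx : closure N x.
  apply/closure_nrmP => e e0.
  have l1 : 0 < 1 + nrm l by rewrite ltr_wpDr ?nrm_ge0.
  have [z Nz xz] := (closure_nrmP _ _).1 cx _ (divr_gt0 e0 l1).
  exists (a + (z, l *: z)); first exact: linear_subspaceD lD (AD _ Aa) Nz.
  rewrite gax opprD addrACA subrr add0r nrm_prod gt_max /= -scalerBr nrmZ.
  move: xz; rewrite ltr_pdivlMr //.
  have := nrm_ge0 l; have := nrm_ge0 (x - z) => x0 l0.
  have lx0 : 0 <= nrm l * nrm (x - z) by rewrite mulr_ge0.
  by move=> xz; apply/andP; split; lra.
have [v Nv xv] := projection_theorem lcN (@closed_closure _ N) x.
suff -> : x = v by [].
apply/subr0_eq/inner_eq0; set y := x - v.
have yN z : N z -> inner y z = 0 by move/subset_closure; exact: xv.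
rewrite {2}/y innerBr (xv _ Nv) subr0.
(* A vector [y] orthogonal to [N] is [b.2 - l^* b.1] for some [b] in the
   kernel of [G], and so it is orthogonal to [x] as well. *)
have [b Ab bl] := selfadjoint_range saA (nonreal_conj lNR) y.
have kb : rel_ker G b.
  rewrite -adjoint_rel_dom => t tD; apply/subr0_eq.
  have [c Ac [z tcz]] := selfadjoint_decomposition saA lNR t.
  have Nz : N z.
    by have := linear_subspaceB lD tD (AD _ Ac); rewrite tcz addrC addKr.
  have bc : inner c.2 b.1 = inner c.1 b.2.
    exact: selfadjoint_symmetric saA _ Ab _ Ac.
  rewrite tcz /= !innerDl innerZl bc.
  transitivity (inner z (Num.conj l *: b.1 - b.2)).
    by rewrite innerBr innerZr conjCK; ring.
  by rewrite -opprB innerNr bl (inner_sym0 (yN _ Nz)) oppr0.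
have := xS _ kb; rewrite /= innerZr => E.
suff : inner (b.2 - Num.conj l *: b.1) x = 0 by rewrite bl.
by rewrite innerBl innerZl E subrr.
Qed.

Lemma conditions_B_boundary_relation : boundary_relation (rel_ker G) G.
Proof.
have [lG gG _ _] := BG; split => //; last exact: conditions_B_maximal.
split; last exact: rel_dom_dense.
move=> f [h Gf] g Gg; apply/esym/subr0_eq.
by rewrite -opprB (gG _ _ _ _ Gg Gf) !inner0l subrr oppr0.
Qed.

(** Existence: split an element of [G] with first boundary value [h] along
    [ker_Gamma0 G] to move it onto the line of slope [l].  Uniqueness: over
    [h = 0] this line meets [ker_Gamma0 G] only in zero, and the multivalued
    part of [G] is orthogonal to all first boundary values. *)
Lemma weyl_exists l : l \isn't Num.real ->
  exists W : K -> K, weyl_family G l = graph W.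
Proof.
move=> lNR; have [lG gG ranG saA] := BG.
have /choice[W WP] h : exists h', weyl_family G l (h, h').
  have [f [h' Gf]] : ran_Gamma0 G h by rewrite ranG.
  have [a [k Ga] [z faz]] := selfadjoint_decomposition saA lNR f.
  exists (h' - k), z; have := linear_subspaceB lG Gf Ga.
  congr G; rewrite faz; congr pair; first by rewrite addrC addKr.
  by congr pair; rewrite subr0.
exists W; apply/seteqP; split=> [[h h'] [f Gf]|[h h']]; last first.
  by rewrite /graph /= => ->; exact: WP.
rewrite /graph /=; have [f' Gf'] := WP h.
have := linear_subspaceB lG Gf Gf'.
rewrite (_ : _ - _ = ((f - f', l *: (f - f')), (0, h' - W h))); last first.
  by congr (_, _); congr pair; rewrite ?subrr //= scalerBr.
move=> Gd.
have /(symmetric_eigen0 (selfadjoint_symmetric saA) lNR) d0 :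
  ker_Gamma0 G (f - f', l *: (f - f')) by exists (h' - W h).
apply/subr0_eq/inner_eq0; move: Gd; rewrite d0 scaler0 => Gd.
have [a [k Ga]] : ran_Gamma0 G (h' - W h) by rewrite ranG.
have := gG _ _ _ _ Gd Ga.
by rewrite /green_identity /= !inner0l !subr0 => ->.
Qed.

(** On the lines of slopes [l] and [l^*] the left side of Green's identity
    vanishes. *)
Lemma weyl_adjoint l W W' :
  weyl_family G l = graph W -> weyl_family G (Num.conj l) = graph W' ->
  forall u v, inner (W u) v = inner u (W' v).
Proof.
move=> EW EW' u v; have [_ gG _ _] := BG.
have [f Gf] : weyl_family G l (u, W u) by rewrite EW.
have [g Gg] : weyl_family G (Num.conj l) (v, W' v) by rewrite EW'.
have := gG _ _ _ _ Gf Gg.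
by rewrite /green_identity /= innerZl innerZr conjCK subrr => /esym/subr0_eq.
Qed.

Theorem weyl_bounded l : l \isn't Num.real ->
  exists2 W : K -> K, weyl_family G l = graph W & bounded_operator W.
Proof.
move=> lNR; have [W EW] := weyl_exists lNR.
have [W' EW'] := weyl_exists (nonreal_conj lNR).
by exists W => //; apply: hellinger_toeplitz (weyl_adjoint EW EW').
Qed.

End ConditionsB.

(** * Equality of defect numbers *)

Section Dimension.
Variables (R : realType) (H : hilbertType R).
Implicit Types (N B : set H).

Definition orthonormal B :=
  (forall e, B e -> inner e e = 1) /\
  (forall e e', B e -> B e' -> e <> e' -> inner e e' = 0).

(** A maximal orthonormal subset, by Zorn's lemma.  Maximality against the unit
    vectors of [N] is what [orthonormal_basis] asks for. *)
Lemma exists_orthonormal_basis N : linear_subspace N ->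
  exists B, orthonormal_basis N B.
Proof.
move=> lN.
have [F FP totF|B [[BN onB] Bmax]] :=
    @Zorn_bigcup H [set B | B `<=` N /\ orthonormal B].
  split; first by move=> e [B FB Be]; exact: (FP _ FB).1.
  split=> [e [B FB Be]|e e' [B FB Be] [C FC Ce']]; first exact: (FP _ FB).2.1.
  by have [BC|CB] := totF _ _ FB FC; [apply: (FP _ FC).2.2 => //; exact: BC|
    apply: (FP _ FB).2.2 => //; exact: CB].
exists B; split => //; [by case: onB|by case: onB|].
move=> x Nx xB; apply: contrapT => x0.
have nx : nrm x != 0 by apply/eqP => /nrm_eq0.
pose e := (nrm x)^-1%:C *: x.
have ee : inner e e = 1.
  by rewrite inner_nrm nrmZ nrm_real ger0_norm ?invr_ge0 ?nrm_ge0 // mulVf // expr1n.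
have eB b : B b -> inner e b = 0 by move=> Bb; rewrite innerZl xB // mulr0.
apply: (Bmax (B `|` [set e])).
  split; first exact: subsetUl.
  move=> sub; have /eB : B e by apply: sub; right.
  by move=> /eqP; rewrite ee oner_eq0.
split; first by move=> _ [/BN|->] //; exact: linear_subspaceZ.
split=> [_ [/onB.1|->]|b c [Bb|->] [Bc|->]] //; first exact: onB.2.
- by move=> _; apply: inner_sym0; exact: eB.
- by move=> _; exact: eB.
Qed.

(** Two distinct vectors of [B] are at distance [sqrt 2 > 1], so one point of a
    dense set is within [1/2] of at most one of them. *)
Lemma orthonormal_countable B : separable H -> orthonormal B -> countable B.
Proof.
move=> [D [cD dD]] [B1 B0].
have near e : exists d, D d /\ nrm (e - d) < 2^-1.
  have [||d [ed Dd]] := dD (interior [set d | nrm (e - d) < 2^-1]).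
  - exists e; rewrite /interior /=; apply/nbhs_nrmP; exists 2^-1 => //.
  - exact: open_interior.
  by exists d; split => //; exact: (interior_subset ed).
have [f fP] := choice near.
have finj : {in B &, injective f}.
  move=> e e' /set_mem Be /set_mem Be' fe; apply: contrapT => ee'.
  have := nrm_triangle (f e) e e'; have [_ ef] := fP e; have [_ ef'] := fP e'.
  rewrite [nrm (f e - e')]nrm_distC {2}fe => tri.
  have : nrm (e - e') < 1 by lra.
  have oee' : inner e (- e') = 0 by rewrite innerNr (B0 _ _ Be Be' ee') oppr0.
  have n1 b : B b -> nrm b ^+ 2 = 1.
    by move=> Bb; apply/complexI; rewrite -inner_nrm B1.
  have := pythagoras oee'; rewrite nrmN (n1 _ Be) (n1 _ Be') => E lt1.
  have : nrm (e - e') ^+ 2 < 1 by rewrite expr_lt1 // nrm_ge0.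
  by rewrite E; lra.
rewrite -(eq_countable (inj_card_eq finj)); apply: sub_countable cD.
by apply: subset_card_le => _ [e _ <-]; case: (fP e).
Qed.

(** If [n < m], the [m] by [n] matrix of the inner products of [phi (f j)] with
    the basis [B'] has a nonzero vector in its row kernel.  The corresponding
    combination of the vectors [f j] is nonzero, but its image is orthogonal to
    [B'], hence zero. *)
Lemma orthonormal_card_le N N' B B' (phi : H -> H) m n :
  linear_subspace N -> B `<=` N -> orthonormal B -> orthonormal_basis N' B' ->
  linear phi -> (forall x, N x -> N' (phi x)) ->
  (forall x, N x -> phi x = 0 -> x = 0) ->
  (`I_m #<= B)%card -> (B' #= `I_n)%card -> (m <= n)%N.
Proof.
move=> lN BN [B1 B0] [_ _ _ B'max] lphi phiN phi0 /pcard_leP[f].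
rewrite card_eq_sym card_eq_le => /andP[_ /pcard_surjP[g gB']].
rewrite leqNgt; apply/negP => nm.
pose F (j : 'I_m) := f j.
have FB j : B (F j) by apply: funS => /=.
pose C : 'M[R[i]]_(m, n) := \matrix_(j, i) inner (phi (F j)) (g i).
have : kermx C != 0.
  rewrite kermx_eq0 -row_leq_rank -ltnNge.
  exact: leq_ltn_trans (rank_leq_col C) nm.
case/rowV0Pn => v /sub_kermxP vC; apply/negP; rewrite negbK.
pose x := \sum_j v 0 j *: F j.
have phiD a u w : phi (a *: u + w) = a *: phi u + phi w by exact: lphi.
have phi_sum : phi x = \sum_j v 0 j *: phi (F j).
  rewrite /x; elim/big_rec2: _ => [|j y z _ <-]; last exact: phiD.
  by apply: (addIr (phi 0)); rewrite add0r -{1}[phi 0]scale1r -phiD scaler0 add0r.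
have Nx : N x.
  rewrite /x; elim/big_ind: _ => [|u w|j _]; first by case: lN.
    exact: linear_subspaceD.
  exact: linear_subspaceZ (BN _ (FB j)).
have x0 : x = 0.
  apply: (phi0 _ Nx); apply: B'max; first exact: phiN.
  move=> _ /gB'[i /= im <-].
  have := congr1 (fun A : 'rV__ => A 0 (Ordinal im)) vC; rewrite !mxE => <-.
  rewrite phi_sum inner_suml; apply: eq_bigr => j _.
  by rewrite innerZl mxE.
apply/eqP/rowP => k; rewrite mxE.
have := inner0l (F k); rewrite -x0 inner_suml (bigD1 k) //= big1 => [|j jk].
  by rewrite addr0 innerZl B1 // mulr1.
rewrite innerZl B0 ?mulr0 // => Fjk; move/eqP: jk; apply; apply/val_inj.
by apply: (@inj _ _ _ f) => //; rewrite inE /=.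
Qed.

(** The orthonormal bases are countable: if both are infinite they are
    equipotent to [nat], and otherwise [orthonormal_card_le] compares them in
    both directions. *)
Lemma same_hilbert_dimension_of_injections N N' (phi psi : H -> H) :
  separable H -> linear_subspace N -> linear_subspace N' ->
  linear phi -> (forall x, N x -> N' (phi x)) ->
  (forall x, N x -> phi x = 0 -> x = 0) ->
  linear psi -> (forall x, N' x -> N (psi x)) ->
  (forall x, N' x -> psi x = 0 -> x = 0) ->
  same_hilbert_dimension N N'.
Proof.
move=> sep lN lN' lphi phiN phi0 lpsi psiN psi0.
have [B bB] := exists_orthonormal_basis lN.
have [B' bB'] := exists_orthonormal_basis lN'.
have [BN B1 B0 _] := bB; have [BN' B1' B0' _] := bB'.
have le m n := @orthonormal_card_le N N' B B' phi m n
  lN BN (conj B1 B0) bB' lphi phiN phi0.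
have le' m n := @orthonormal_card_le N' N B' B psi m n
  lN' BN' (conj B1' B0') bB lpsi psiN psi0.
exists B, B'; split => //.
have cB := orthonormal_countable sep (conj B1 B0).
have cB' := orthonormal_countable sep (conj B1' B0').
have inf (C : set H) m : ~ finite_set C -> (`I_m #<= C)%card.
  move=> /infiniteP; apply: card_le_trans; exact: subset_card_le.
have [[m Bm]|iB] := pselect (finite_set B); last first.
  have [[n B'n]|iB'] := pselect (finite_set B').
    by have := le n.+1 n (inf _ _ iB) B'n; rewrite ltnn.
  apply: card_eq_trans (eq_card_nat cB iB) _.
  by rewrite card_eq_sym; exact: eq_card_nat.
have [[n B'n]|iB'] := pselect (finite_set B'); last first.
  by have := le' m.+1 m (inf _ _ iB') Bm; rewrite ltnn.
rewrite (card_eql Bm) card_eq_sym (card_eql B'n).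
apply/card_eq_II/eqP; rewrite eqn_leq.
rewrite (le' _ _ _ Bm) ?(le _ _ _ B'n) //.
  by rewrite (card_le_eqr Bm).
by rewrite (card_le_eqr B'n).
Qed.

(** Let [z] be the resolvent of [A] at [mu] applied to [(l - mu) *: x].  If
    [(x, l *: x)] is in [adjoint S], so is [(x - z, mu *: (x - z))]; and
    [x = z] puts [(x, l *: x)] into [A], where only [x = 0] is possible. *)
Lemma defect_injection (A S : set (H * H)) (l mu : R[i]) :
  selfadjoint_relation A -> A `<=` adjoint S ->
  l \isn't Num.real -> mu \isn't Num.real ->
  exists phi : H -> H, [/\ linear phi,
    forall x, defect_subspace S l x -> defect_subspace S mu (phi x) &
    forall x, defect_subspace S l x -> phi x = 0 -> x = 0].
Proof.
move=> saA AS lNR muNR.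
have [Res lRes ResP] := selfadjoint_resolvent saA muNR.
exists (fun x => x - (l - mu) *: Res x); split.
- by move=> a u v; rewrite lRes; vector_ring.
- move=> x Sx; have [lA _] := saA.
  have := linear_subspaceB (adjoint_linear S) Sx
    (AS _ (linear_subspaceZ (l - mu) lA (ResP x))).
  by congr (adjoint S (_, _)) => /=; vector_ring.
move=> x Sx /subr0_eq xE; have [lA _] := saA.
apply: (symmetric_eigen0 (selfadjoint_symmetric saA) lNR).
have := linear_subspaceZ (l - mu) lA (ResP x).
rewrite {2}xE.
by congr (A (_, _)) => /=; [rewrite -xE|rewrite {3}xE; vector_ring].
Qed.

Theorem equal_defect_numbers_of_selfadjoint_extension (A S : set (H * H)) :
  separable H -> selfadjoint_relation A -> A `<=` adjoint S ->
  equal_defect_numbers S.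
Proof.
move=> sep saA AS l mu l0 mu0.
have lNR : l \isn't Num.real.
  by apply: contraL l0 => /RIm_real [->]; rewrite ltxx.
have muNR : mu \isn't Num.real.
  by apply: contraL mu0 => /RIm_real [->]; rewrite ltxx.
have lin (nu : R[i]) : linear_subspace (defect_subspace S nu).
  split; first by rewrite /defect_subspace /= scaler0; case: (adjoint_linear S).
  move=> c u v Su Sv; have := (adjoint_linear S).2 c _ _ Su Sv.
  by congr (adjoint S (_, _)) => /=; vector_ring.
have [phi [lphi phiN phi0]] := defect_injection saA AS lNR muNR.
have [psi [lpsi psiN psi0]] := defect_injection saA AS muNR lNR.
exact: same_hilbert_dimension_of_injections lphi phiN phi0 lpsi psiN psi0.
Qed.

End Dimension.

(** * Compression to a summand of the boundary space *)

Lemma linear_operations (R : realType) (U V : lmodType R[i]) (A : U -> V) :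
  linear A ->
  [/\ forall u v, A (u + v) = A u + A v, forall a u, A (a *: u) = a *: A u &
      forall u, A (- u) = - A u].
Proof.
move=> lA.
have AD u v : A (u + v) = A u + A v by have := lA 1 u v; rewrite !scale1r.
have A0 : A 0 = 0 by apply: (addrI (A 0)); rewrite -AD !addr0.
have AZ a u : A (a *: u) = a *: A u.
  by have := lA a u 0; rewrite A0 !addr0.
by split=> // u; rewrite -scaleN1r AZ scaleN1r.
Qed.

Section Coordinates.
Variables (R : realType) (K K1 K2 : hilbertType R).
Variable D : orthogonal_decomposition K K1 K2.

(** The two embeddings have orthogonal ranges and are injective. *)
Lemma coordinates_unique u v h : inj1 D u + inj2 D v = h ->
  proj1 D h = u /\ proj2 D h = v.
Proof.
move=> uvh; pose x := u - proj1 D h; pose y := v - proj2 D h.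
have xy : inj1 D x + inj2 D y = 0.
  by rewrite !linearB /= addrACA -opprD -proj_split uvh subrr.
split; apply/esym/subr0_eq/inner_eq0.
- have : inner (inj1 D x + inj2 D y) (inj1 D x) = 0 by rewrite xy inner0l.
  by rewrite innerDl (inj1_isometry D) (inner_sym0 (inj_orthogonal D _ _)) addr0.
- have : inner (inj1 D x + inj2 D y) (inj2 D y) = 0 by rewrite xy inner0l.
  by rewrite innerDl (inj2_isometry D) (inj_orthogonal D) add0r.
Qed.

Lemma proj1_inj1 x : proj1 D (inj1 D x) = x.
Proof.
by have [] := @coordinates_unique x 0 (inj1 D x); rewrite ?linear0 ?addr0.
Qed.

Lemma proj2_inj1 x : proj2 D (inj1 D x) = 0.
Proof.
by have [] := @coordinates_unique x 0 (inj1 D x); rewrite ?linear0 ?addr0.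
Qed.

Lemma proj1_inj2 x : proj1 D (inj2 D x) = 0.
Proof.
by have [] := @coordinates_unique 0 x (inj2 D x); rewrite ?linear0 ?add0r.
Qed.

Lemma proj2_eq0 h : proj2 D h = 0 -> h = inj1 D (proj1 D h).
Proof. by move=> h2; rewrite [LHS](proj_split D) h2 linear0 addr0. Qed.

Lemma proj1_eq0 h : proj1 D h = 0 -> h = inj2 D (proj2 D h).
Proof. by move=> h1; rewrite [LHS](proj_split D) h1 linear0 add0r. Qed.

Lemma inner_inj1l x h : inner (inj1 D x) h = inner x (proj1 D h).
Proof.
rewrite {1}(proj_split D h) innerDr (inj1_isometry D) (inj_orthogonal D).
by rewrite addr0.
Qed.

Lemma inner_inj1r h x : inner h (inj1 D x) = inner (proj1 D h) x.
Proof. by rewrite innerC inner_inj1l -innerC. Qed.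

End Coordinates.

Section Compression.
Variables (R : realType) (H K K1 K2 : hilbertType R).
Variable D : orthogonal_decomposition K K1 K2.
Variable G : set ((H * H) * (K * K)).
Hypothesis BG : conditions_B G.
Hypothesis BG2 : conditions_B (transposed (Gamma_2 D G)).

(** Both kernels consist of the [f] related by [G] to some [(h, h')] with
    [proj1 D h = 0] and [proj2 D h' = 0]. *)
Lemma ker_Gamma0_prime :
  ker_Gamma0 (Gamma_prime D G) = ker_Gamma0 (transposed (Gamma_2 D G)).
Proof.
apply/seteqP; split=> f /=.
- move=> [k [h [h' [Gf [h1 _]]]]].
  exists ('i *: proj2 D h), (proj2 D h, 0); split; last first.
    by rewrite /Jmap /= scaler0 oppr0.
  exists (proj2 D h), (inj1 D h'); split; last by rewrite proj2_inj1.
  by rewrite -(proj1_eq0 (esym h1)).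
- move=> [k [_ [[h [h' [/= Gf ->]]] [/esym/eqP h2 _]]]].
  move: h2; rewrite oppr_eq0 scaler_eq0 (negPf (neq0Ci _)) /= => /eqP h2.
  exists (proj1 D h'), (inj2 D h), (proj1 D h').
  by rewrite /= -(proj2_eq0 h2) proj1_inj2.
Qed.

(** Start from an element of [G] with first boundary value [inj1 D x]; an element
    with first boundary value in [K2] cancels the [K2]-component of the second
    one without changing the [K1]-component of the first. *)
Lemma ran_Gamma0_prime : ran_Gamma0 (Gamma_prime D G) = setT.
Proof.
have [lG _ ranG _] := BG; have [_ _ ranG2 _] := BG2.
apply/seteqP; split=> // x _.
have [f [h' Gf]] : ran_Gamma0 G (inj1 D x) by rewrite ranG.
have [g [j [_ [[k [k' [/= Gg ->]]] [/= kE _]]]]] :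
  ran_Gamma0 (transposed (Gamma_2 D G)) (- ('i *: proj2 D h')) by rewrite ranG2.
have {}kE : proj2 D h' = proj2 D k' by apply: (scalerI (neq0Ci _)); exact: oppr_inj.
exists (f - g), (proj1 D (h' - k')), (inj1 D x - inj2 D k), (proj1 D (h' - k')).
split; last by rewrite /= [proj1 D (inj1 D _ - _)]linearB /= proj1_inj1 proj1_inj2 subr0.
have := linear_subspaceB lG Gf Gg.
by rewrite -proj2_eq0 // linearB /= kE subrr.
Qed.

Lemma conditions_B_prime : conditions_B (Gamma_prime D G).
Proof.
have [lG gG _ _] := BG; have [_ _ _ sa2] := BG2.
split; last by rewrite ker_Gamma0_prime.
- split; first by exists 0, 0; rewrite /= !linear0; split => //; case: lG.
  move=> a [f _] [g _] [h [h' [/= Gf ->]]] [k [k' [/= Gg ->]]].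
  exists (a *: h + k), (a *: h' + k'); split; last by rewrite /= [proj1 D (_ + _)]linearP.
  by rewrite [inj1 D (_ + _)]linearP; exact: lG.2 _ _ _ Gf Gg.
- move=> f _ g _ [h [h' [/= Gf ->]]] [k [k' [/= Gg ->]]].
  by rewrite /green_identity (gG _ _ _ _ Gf Gg) /= inner_inj1l inner_inj1r.
- exact: ran_Gamma0_prime.
Qed.

Lemma rel_ker_prime (S : set (H * H)) : rel_dom G `<=` adjoint S ->
  rel_ker (Gamma_prime D G) = S_1 D S G.
Proof.
move=> GS; apply/seteqP; split=> f.
- move=> [h [h' [Gf]]] [] h1 h'0; move: Gf; rewrite -h'0 linear0 => Gf.
  split; first by apply: GS; exists (h, 0).
  by exists (proj2 D h); rewrite -proj1_eq0.
- move=> [_ [h Gf]]; exists (inj2 D h), 0.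
  by rewrite /= linear0 proj1_inj2.
Qed.

(** The Weyl operator [N] of the transposed [Gamma_2] sends [- ('i *: M22 x)] to
    ['i *: x], where [M22] is [block22 D W]; by linearity [N (M22 x) = - x]. *)
Lemma block22_inverse l W : l \isn't Num.real ->
  weyl_family G l = graph W -> linear W ->
  exists V, bounded_inverse (block22 D W) V.
Proof.
move=> lNR EW lW; have [N EN [lN [c Nc]]] := weyl_bounded BG2 lNR.
have [WD WZ WN] := linear_operations lW; have [ND NZ NN] := linear_operations lN.
have NW x : N (- ('i *: block22 D W x)) = 'i *: x.
  have : weyl_family G l (inj2 D x, W (inj2 D x)) by rewrite EW.
  move=> [f Gf].
  suff : graph N (- ('i *: block22 D W x), 'i *: x) by move=> /= <-.
  rewrite -EN; exists f, (x, block22 D W x); split => //.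
  by exists x, (W (inj2 D x)).
exists (fun y => - N y); split.
- split; first by move=> a u v; rewrite lN; vector_ring.
  by exists c => x; rewrite normrN.
- move=> x; apply: (scalerI (neq0Ci _)).
  by rewrite -[RHS]NW NN NZ scalerN.
- move=> y; have : weyl_family (transposed (Gamma_2 D G)) l (y, N y) by rewrite EN.
  move=> [f [_ [[x [x' [/= Gf ->]]] [/= -> ->]]]].
  have : graph W (inj2 D x, x') by rewrite -EW; exists f.
  rewrite /graph /= => ->; rewrite /block22.
  by rewrite linearN linearZ /= WN WZ linearN linearZ.
Qed.

(** With [v := M22^-1 M21 h] the boundary value [u := h - v] has [W u] in [K1],
    so that it is admitted in [Gamma_prime]; its [K1]-component is [h]. *)
Lemma weyl_prime l W W1 V : weyl_family G l = graph W -> linear W ->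
  weyl_family (Gamma_prime D G) l = graph W1 ->
  cancel V (block22 D W) ->
  forall h, W1 h = block11 D W h - block12 D W (V (block21 D W h)).
Proof.
move=> EW lW EW1 VK h; have [WD WZ WN] := linear_operations lW.
set v := V _; pose u := inj1 D h - inj2 D v.
have Wu2 : proj2 D (W u) = 0.
  by rewrite WD WN linearB /= -[proj2 D (W (inj2 D v))]/(block22 D W v) VK subrr.
have [f Gf] : weyl_family G l (u, W u) by rewrite EW.
have : graph W1 (h, proj1 D (W u)).
  rewrite -EW1; exists f, u, (proj1 D (W u)); rewrite /= -(proj2_eq0 Wu2).
  by rewrite [proj1 D (inj1 D _ - _)]linearB /= proj1_inj1 proj1_inj2 subr0.
by rewrite /graph /= => <-; rewrite WD WN linearB.
Qed.

End Compression.

Theorem corollary5p3 (R : realType) (H K K1 K2 : hilbertType R)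
    (D : orthogonal_decomposition K K1 K2)
    (S : set (H * H)) (Gamma : set ((H * H) * (K * K)))
    (separable_H : separable H)
    (S_closed_symmetric : closed_symmetric_relation S)
    (S_operator : single_valued S)
    (Gamma_boundary : boundary_relation S Gamma)
    (Gamma_B : conditions_B Gamma)
    (Gamma_transposed_B : conditions_B (transposed Gamma))
    (Gamma_2_transposed_B : conditions_B (transposed (Gamma_2 D Gamma))) :
  let M := weyl_function Gamma in
  let S1 := S_1 D S Gamma in
  let Gamma' := Gamma_prime D Gamma in
  let M1 := weyl_function Gamma' in
  [/\ closed_symmetric_relation S1 /\ equal_defect_numbers S1,
      boundary_relation S1 Gamma' /\ conditions_B Gamma' &
      forall lambda : R[i], lambda \isn't Num.real ->
        [/\ weyl_family Gamma' lambda = graph (M1 lambda),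
            bounded_operator (M1 lambda) &
            exists2 M22_inv : K2 -> K2,
              bounded_inverse (block22 D (M lambda)) M22_inv &
              forall h : K1,
                M1 lambda h = block11 D (M lambda) h
                  - block12 D (M lambda) (M22_inv (block21 D (M lambda) h))]].
Proof.
move=> M S1 Gamma' M1.
have B' : conditions_B Gamma' by exact: conditions_B_prime.
have GS : rel_dom Gamma `<=` adjoint S by case: Gamma_boundary => _ [].
have S1E : S1 = rel_ker Gamma' by rewrite /S1 -rel_ker_prime.
split.
- rewrite S1E; split; first exact: rel_ker_closed_symmetric.
  have [_ _ _ saA] := B'.
  apply: (equal_defect_numbers_of_selfadjoint_extension separable_H saA).
  by rewrite -saA.2; exact/adjoint_sub/rel_ker_sub_ker_Gamma0.
- by split => //; rewrite S1E; exact: conditions_B_boundary_relation.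
- move=> lambda lNR.
  have [W EW [lW _]] := weyl_bounded Gamma_B lNR.
  have [W1 EW1 bW1] := weyl_bounded B' lNR.
  have -> : M lambda = W by exact: weyl_functionP.
  have -> : M1 lambda = W1 by exact: weyl_functionP.
  have [V VP] := block22_inverse Gamma_2_transposed_B lNR EW lW.
  split => //; exists V => //.
  by apply: weyl_prime EW lW EW1 _; case: VP.
Qed.
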